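(* Let $\Bbbk$ be a field of characteristic zero and let $L=\Bbbk x\oplus\Bbbk y$ be the two-dimensional vector space with basis $x,y$ and bilinear product $\triangleright$ determined by $$x\triangleright y=y,\qquad x\triangleright x=y\triangleright x=y\triangleright y=0.$$ Then $(L,\triangleright)$ is a preLie algebra which does not have property $A_{\mathrm{preAs}}$; that is, there is no injective homomorphism of preLie algebras from $L$ into the induced preLie algebra of a finite-dimensional preassociative algebra over $\Bbbk$.
   Context: All algebras are over the field $\Bbbk$. A preLie algebra is a vector space $L$ with a bilinear product $\triangleright$ satisfying $(x\triangleright y)\triangleright z-x\triangleright(y\triangleright z)=(y\triangleright x)\triangleright z-y\triangleright(x\triangleright z)$ for all $x,y,z\in L$. A preassociative algebra is a vector space with two bilinear operations $\prec,\succ$ satisfying, for all $a,b,c$, $(a\prec b)\prec c=a\prec(b*c)$, $(a\succ b)\prec c=a\succ(b\prec c)$, $(a*b)\succ c=a\succ(b\succ c)$, where $a*b=a\succ b+a\prec b$. Its induced preLie algebra is the same vector space with the product $a\triangleright b=a\succ b-b\prec a$. A finite-dimensional preLie algebra $L$ has property $A_{\mathrm{preAs}}$ if it embeds (via an injective homomorphism of preLie algebras) into the induced preLie algebra of a finite-dimensional preassociative algebra. *)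

(* Defs.v *)
From HB Require Import structures.
From mathcomp Require Import all_boot all_order all_algebra.

Set Implicit Arguments.
Unset Strict Implicit.
Unset Printing Implicit Defensive.
Import GRing.Theory.
Local Open Scope ring_scope.

Definition is_preLie (k : fieldType) (L : lmodType k)
    (op : {bilinear L -> L -> L}) : Prop :=
  forall x y z : L,
    op (op x y) z - op x (op y z) = op (op y x) z - op y (op x z).

Definition preAs_mul (k : fieldType) (A : lmodType k)
    (prec succ : {bilinear A -> A -> A}) (a b : A) : A :=
  succ a b + prec a b.

Definition is_preassociative (k : fieldType) (A : lmodType k)
    (prec succ : {bilinear A -> A -> A}) : Prop :=
  forall a b c : A,
    [/\ prec (prec a b) c = prec a (preAs_mul prec succ b c),
        prec (succ a b) c = succ a (prec b c)
      & succ (preAs_mul prec succ a b) c = succ a (succ b c)].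

Definition preAs_preLie (k : fieldType) (A : lmodType k)
    (prec succ : {bilinear A -> A -> A}) (a b : A) : A :=
  succ a b - prec b a.

Lemma preAs_preLie_is_bilinear (k : fieldType) (A : lmodType k)
    (prec succ : {bilinear A -> A -> A}) :
  bilinear_for *:%R *:%R (preAs_preLie prec succ).
Proof.
split=> [c a u v|c a u v]; rewrite /preAs_preLie /=.
  by rewrite linearPl linearPr /= scalerBr opprD addrACA.
by rewrite linearPr linearPl /= scalerBr opprD addrACA.
Qed.

HB.instance Definition _ (k : fieldType) (A : lmodType k)
    (prec succ : {bilinear A -> A -> A}) :=
  bilinear_isBilinear.Build k A A A *:%R *:%R (preAs_preLie prec succ)
    (preAs_preLie_is_bilinear prec succ).

Lemma preAs_preLieP (k : fieldType) (A : lmodType k)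
    (prec succ : {bilinear A -> A -> A}) :
  is_preassociative prec succ -> is_preLie (preAs_preLie prec succ).
Proof.
move=> pA x y z; rewrite /= /preAs_preLie.
have [_ _] := pA x y z; rewrite /preAs_mul linearDl => sxy.
have [_ _] := pA y x z; rewrite /preAs_mul linearDl => syx.
have [+ _ _] := pA z x y; rewrite /preAs_mul linearDr => zxy.
have [+ _ _] := pA z y x; rewrite /preAs_mul linearDr => zyx.
have [_ xzy _] := pA x z y; have [_ yzx _] := pA y z x.
rewrite !(linearBl, linearBr) /= -sxy -syx zxy zyx xzy yzx.
rewrite !opprD !opprK; apply/eqP; rewrite -subr_eq0 !opprD !opprK.
rewrite !addrA [eqbLHS]
  (ACl (1*5*12*6*15*11*16*2*19*3*4*10*13*9*20*14*7*18*8*17))/=.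
by rewrite !(subrr, add0r).
Qed.

(* Linearity is carried by the type of [f]. *)
Definition is_preLie_morphism (k : fieldType) (L M : lmodType k)
    (opL : {bilinear L -> L -> L}) (opM : {bilinear M -> M -> M})
    (f : {linear L -> M}) : Prop :=
  {morph f : u v / opL u v >-> opM u v}.

Definition has_A_preAs (k : fieldType) (L : vectType k)
    (op : {bilinear L -> L -> L}) : Prop :=
  exists (A : vectType k) (prec succ : {bilinear A -> A -> A}),
    is_preassociative prec succ /\
    exists f : {linear L -> A},
      is_preLie_morphism op (preAs_preLie prec succ) f /\ injective f.

(* A model of the two-dimensional product x |> y = y considered in the theorem. *)
Definition example_op (k : fieldType) (u v : 'rV[k]_2) : 'rV[k]_2 :=
  (u 0 0 * v 0 1) *: delta_mx 0 1.

Lemma example_op_is_bilinear (k : fieldType) :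
  bilinear_for *:%R *:%R (@example_op k).
Proof.
split=> [v c a b|u c a b]; rewrite /example_op /= !mxE scalerA -scalerDl.
  by rewrite mulrDl mulrA.
by rewrite mulrDr mulrCA.
Qed.

HB.instance Definition _ (k : fieldType) :=
  bilinear_isBilinear.Build k 'rV[k]_2 'rV[k]_2 'rV[k]_2 *:%R *:%R
    (@example_op k) (example_op_is_bilinear k).

Lemma exists_two_dim_product (k : fieldType) :
  exists (L : vectType k) (x y : L) (op : {bilinear L -> L -> L}),
    [/\ basis_of fullv [:: x; y], op x y = y, op x x = 0, op y x = 0
      & op y y = 0].
Proof.
exists 'rV[k]_2, (delta_mx 0 0), (delta_mx 0 1), (@example_op k).
split; rewrite /= /example_op ?mxE /= ?mulr1 ?mulr0 ?mul0r ?scale1r ?scale0r //.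
rewrite basisEfree subvf dimvf /= andbT.
apply/(freeP (X := [tuple delta_mx 0 0; delta_mx 0 1])) => c.
rewrite !big_ord_recl big_ord0 addr0 /= => /rowP E.
have := E 0; have := E 1.
rewrite !mxE /= !mulr0 !mulr1 addr0 add0r => c1 c0 i.
by case: i => [[|[|]]//] ?; [rewrite -[RHS]c0|rewrite -[RHS]c1];
  congr c; apply: val_inj.
Qed.

(* Main.v *)
Require Import Defs.
From HB Require Import structures.
From mathcomp Require Import all_boot all_order all_algebra.

Set Implicit Arguments.
Unset Strict Implicit.
Unset Printing Implicit Defensive.
Import GRing.Theory.
Local Open Scope ring_scope.

(** The only products that matter are [x |> x = 0] and [x |> y = y]. Suppose
    that [x] and [y] lie in the induced preLie algebra of a finite-dimensional
    preassociative algebra, and put [l c = x > c] and [r c = c < x], writing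
    [>] and [<] for the two operations and [*] for their sum, which is
    associative. The axioms say that [l] and [r] commute and that
    left [>]-multiplication and right [<]-multiplication are representations
    of [*] on the left and on the right.

    From [x |> x = 0], i.e. [l x = r x], the [*]-power [x ^ (n + 1)] equals
    [(n + 1) l^n x] ([mul_iterE]). Thus [f' (l) x = f (x)] for each polynomial
    [f] with [f (0) = 0], the right-hand side being computed with [*]. As
    [f (x) > c = f (l) c], this gives the key fact: if [p (l) x = 0] and [f] is
    the primitive of [p] without constant term, then [f (l) x = 0]
    ([iter_succ_relation]).

    So the polynomials that annihilate [x] form an ideal which is closed under
    this integration, and which is nonzero by finite dimension. In
    characteristic zero such an ideal contains a monomial: [X p - m f]
    multiplies the coefficient of [X^i] in [p] by [(i + 1 - m) / (i + 1)], so a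
    good [m] removes any chosen coefficient and preserves which of the others
    are nonzero ([iter_annihilates]). If [l^N x = 0], then [x ^ (N + 1) = 0], so
    [l] and [r] are nilpotent as operators. Hence so is the difference [l - r]
    of these commuting operators, but [x |> y = y] says that it fixes [y].
    Therefore [y = 0] ([preAs_fixed_eq0]), and no morphism from [L] is
    injective. *)

(** * Relations stable under integration *)

(** The coefficients of a relation among the [iter i l x] are those of a
    polynomial [p] with [p (l) x = 0]; the hypothesis [int] says that these
    polynomials are stable under integration. If [p] starts in degree [m], then
    [X p - (m + 1) (primitive of p)] starts in degree at least [m + 2] and has
    one term fewer, which drives the induction on [s]. *)
Lemma iter_independent (k : fieldType) (V : lmodType k) (l : {linear V -> V})
    (x : V) (N : nat) (hk : forall n, n.+1%:R != 0 :> k)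
    (int : forall (m s : nat) (c : nat -> k),
      \sum_(i < s) c i *: iter (m + i) l x = 0 ->
      \sum_(i < s) (c i / (m + i).+1%:R) *: iter (m + i).+1 l x = 0)
    (lNx : iter N l x != 0) (s m : nat) (c : nat -> k) :
  (m + s.*2 <= N)%N -> \sum_(i < s) c i *: iter (m + i) l x = 0 ->
  forall i, (i < s)%N -> c i = 0.
Proof.
elim: s m c => [//|s IHs] m c le_ms rel.
have c_succ i : (i < s)%N -> c i.+1 = 0.
  move=> lt_is.
  suff /eqP: c i.+1 * (i.+1%:R / (m + i.+1).+1%:R) = 0.
    by rewrite !mulf_eq0 invr_eq0 !(negPf (hk _)) !orbF => /eqP.
  apply: (IHs m.+2 (fun j => c j.+1 * (j.+1%:R / (m + j.+1).+1%:R))) lt_is.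
    by rewrite !addSn -!addnS -doubleS.
  (* The coefficients of [X p - (m + 1) f], with [f] the primitive of [p]. *)
  have: l (\sum_(i < s.+1) c i *: iter (m + i) l x)
        - m.+1%:R *: (\sum_(i < s.+1) (c i / (m + i).+1%:R)
                                       *: iter (m + i).+1 l x) = 0.
    by rewrite int // rel linear0 scaler0 subr0.
  rewrite linear_sum /= scaler_sumr -sumrB big_ord_recl /= !addn0.
  rewrite linearZ /= scalerA mulrCA divff ?hk // mulr1 subrr add0r => rel'.
  rewrite -[RHS]rel'.
  apply: eq_bigr => j _; rewrite linearZ /= scalerA -scalerBl.
  rewrite /bump /= add1n addnS; congr (_ *: _).
  rewrite [X in _ = _ - X]mulrCA -[X in _ = X - _]mulr1 -mulrBr.
  congr (_ * _); apply: (mulIf (hk (m + j).+1)).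
  rewrite mulrBl mul1r !mulfVK ?hk //.
  by rewrite -addnS -addSn natrD addrAC subrr add0r.
case=> [_|i]; last exact: c_succ.
move: rel; rewrite big_ord_recl big1 => [|i _]; last first.
  by rewrite lift0 c_succ ?scale0r.
rewrite addr0 addn0 => /eqP; rewrite scaler_eq0 => /orP[/eqP //|/eqP lmx].
case/eqP: lNx; rewrite -(subnK (leq_trans (leq_addr _ _) le_ms)) iterD lmx.
by elim: (N - m)%N => //= n ->; rewrite linear0.
Qed.

(** Finite dimension forces a relation among the [iter i l x], which
    [iter_independent] excludes as long as high enough iterates are nonzero. *)
Lemma iter_annihilates (k : fieldType) (V : vectType k) (l : {linear V -> V})
    (x : V) (hk : forall n, n.+1%:R != 0 :> k)
    (int : forall (m s : nat) (c : nat -> k),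
      \sum_(i < s) c i *: iter (m + i) l x = 0 ->
      \sum_(i < s) (c i / (m + i).+1%:R) *: iter (m + i).+1 l x = 0) :
  exists N, iter N l x = 0.
Proof.
(* Eliminating a term raises the starting degree by two, so a relation among
   [d] iterates may lead to a monomial of degree up to about [2 d]. *)
set d := (\dim {:V}).+1; exists d.*2; apply/eqP/negPn/negP => lNx.
pose X := [tuple iter i l x | i < d].
have freeX : free X.
  apply/freeP => c rel i.
  have := iter_independent hk int lNx (m := 0) (c := fun j => c (inord j))
    (leqnn _) _ (ltn_ord i).
  rewrite inord_val => -> //; rewrite -[RHS]rel; apply: eq_bigr => j _.
  by rewrite inord_val -tnth_nth tnth_mktuple.
have := dimvS (subvf <<X>>%VS).
by rewrite (eqnP freeX) size_tuple ltnn.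
Qed.

(** * Elements with [x |> x = 0] in a preassociative algebra *)

(** Left [succ]-multiplication represents the associative product; here it is
    applied to a power of [x]. *)
Lemma succ_mul_iter (k : fieldType) (A : lmodType k)
    (prec succ : {bilinear A -> A -> A})
    (pA : is_preassociative prec succ) (x : A) (n : nat) (c : A) :
  succ (iter n (fun a => preAs_mul prec succ a x) x) c = iter n.+1 (succ x) c.
Proof.
elim: n c => [//|n IHn] c; rewrite iterS.
have [_ _ ->] := pA (iter n (fun a => preAs_mul prec succ a x) x) x c.
by rewrite IHn -iterSr.
Qed.

(** The analogue of [d (x^(n+1)) = (n + 1) x^n dx]: multiplying the [n]-th
    power by [x] gives [l^n x] from [succ], and [prec] contributes [n] further
    copies because [prec^~ x] commutes with [l] and agrees with it at [x]. *)
Lemma mul_iterE (k : fieldType) (A : lmodType k)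
    (prec succ : {bilinear A -> A -> A}) (x : A)
    (pA : is_preassociative prec succ) (xx : succ x x = prec x x) (n : nat) :
  iter n (fun a => preAs_mul prec succ a x) x = n.+1%:R *: iter n (succ x) x.
Proof.
have iterS_prec i : prec (iter i (succ x) x) x = iter i.+1 (succ x) x.
  elim: i => [//|i IHi] /=.
  by have [_ -> _] := pA x (iter i (succ x) x) x; rewrite IHi.
elim: n => [|n IHn]; first by rewrite scale1r.
rewrite iterS {1}/preAs_mul (succ_mul_iter pA) IHn linearZl_LR /= iterS_prec.
by rewrite -[X in X + _]scale1r -scalerDl -mulrS.
Qed.

Lemma prec_mul_iter (k : fieldType) (A : lmodType k)
    (prec succ : {bilinear A -> A -> A})
    (pA : is_preassociative prec succ) (x : A) (n : nat) (c : A) :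
  prec c (iter n (fun a => preAs_mul prec succ a x) x)
  = iter n.+1 (prec^~ x) c.
Proof.
elim: n => [//|n IHn]; rewrite iterS.
have [<- _ _] := pA c (iter n (fun a => preAs_mul prec succ a x) x) x.
by rewrite IHn.
Qed.

(** By [mul_iterE] the hypothesis is a relation between powers of [x], with
    coefficients [c i / (m + i).+1%:R]; the conclusion is its left action
    on [x]. *)
Lemma iter_succ_relation (k : fieldType) (A : lmodType k)
    (prec succ : {bilinear A -> A -> A}) (x : A)
    (hk : forall n, n.+1%:R != 0 :> k)
    (pA : is_preassociative prec succ) (xx : succ x x = prec x x)
    (m s : nat) (c : nat -> k) :
  \sum_(i < s) c i *: iter (m + i) (succ x) x = 0 ->
  \sum_(i < s) (c i / (m + i).+1%:R) *: iter (m + i).+1 (succ x) x = 0.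
Proof.
move=> rel; rewrite -[RHS](linear0l succ x) -[in RHS]rel.
rewrite (big_morph (succ^~ x) (linearDl succ x) (linear0l succ x)).
apply: eq_bigr => i _; rewrite -(succ_mul_iter pA) (mul_iterE pA xx).
by rewrite !linearZl_LR /= scalerA divfK.
Qed.

(** Left [|>]-multiplication by [x] is the difference of the commuting nilpotent
    operators [succ x] and [prec^~ x], so it has no nonzero fixed vector. *)
Lemma preAs_fixed_eq0 (k : fieldType) (A : vectType k)
    (prec succ : {bilinear A -> A -> A}) (x y : A)
    (hk : forall n, n.+1%:R != 0 :> k)
    (pA : is_preassociative prec succ) (xx : preAs_preLie prec succ x x = 0)
    (xy : preAs_preLie prec succ x y = y) : y = 0.
Proof.
have {}xx : succ x x = prec x x by apply/eqP; rewrite -subr_eq0 -[X in _ == X]xx.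
have [N lNx] := iter_annihilates hk (iter_succ_relation hk pA xx).
have powN0 : iter N (fun a => preAs_mul prec succ a x) x = 0.
  by rewrite (mul_iterE pA xx) lNx scaler0.
have l_nil c : iter N.+1 (succ x) c = 0.
  by rewrite -(succ_mul_iter pA) powN0 linear0l.
have r_nil c : iter N.+1 (prec^~ x) c = 0.
  by rewrite -(prec_mul_iter pA) powN0 linear0r.
have l_iter_r j : succ x (iter j (prec^~ x) y)
    = iter j (prec^~ x) y + iter j.+1 (prec^~ x) y.
  elim: j => [|j IHj]; first by rewrite /= -[X in X + _]xy subrK.
  have [_ + _] := pA x (iter j (prec^~ x) y) x.
  by rewrite IHj linearDl => <-.
(* If [r^(j+1) y = 0], then [l] fixes [r^j y], which vanishes as [l] is
   nilpotent. *)
have step j : iter j.+1 (prec^~ x) y = 0 -> iter j (prec^~ x) y = 0.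
  move=> rj; rewrite -(l_nil (iter j (prec^~ x) y)).
  by elim: N.+1 => //= n <-; rewrite l_iter_r rj addr0.
by elim: N.+1 (r_nil y) => // j IHj /step.
Qed.

(** * The two-dimensional preLie algebra *)

Theorem theorem3p2 (k : fieldType) (hk : [pchar k] =i pred0)
    (L : vectType k) (x y : L) (hxy : basis_of fullv [:: x; y])
    (op : {bilinear L -> L -> L})
    (hop_xy : op x y = y) (hop_xx : op x x = 0)
    (hop_yx : op y x = 0) (hop_yy : op y y = 0) :
  is_preLie op /\ ~ has_A_preAs op.
Proof.
have hk0 n : n.+1%:R != 0 :> k by move/pcharf0P: hk => ->.
split.
  have coordL u : exists a b, u = a *: x + b *: y.
    have := memvf u; rewrite -(span_basis hxy) span_cons span_seq1.
    case/memv_addP=> v /vlineP[a ->] [w /vlineP[b ->] ->].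
    by exists a, b.
  have opE a b c d : op (a *: x + b *: y) (c *: x + d *: y) = (a * d) *: y.
    rewrite linearDl !linearDr !linearZl_LR !linearZr /= hop_xy hop_xx hop_yx.
    by rewrite hop_yy !scaler0 add0r !addr0 scalerA.
  move=> u v w; have [a [b ->]] := coordL u; have [c [d ->]] := coordL v.
  have [e [f ->]] := coordL w.
  have yE z : z *: y = 0 *: x + z *: y by rewrite scale0r add0r.
  have opyE z e' f' : op (z *: y) (e' *: x + f' *: y) = 0.
    by rewrite yE opE mul0r scale0r.
  have opxE a' b' z : op (a' *: x + b' *: y) (z *: y) = (a' * z) *: y.
    by rewrite [in LHS](yE z) opE.
  by rewrite !opE !opyE !opxE mulrCA.
case=> A [prec [succ [pA [f [fM f_inj]]]]].
have : y != 0 by apply: (free_not0 (basis_free hxy)); rewrite !inE eqxx orbT.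
case/eqP; apply: f_inj; rewrite linear0.
apply: (preAs_fixed_eq0 (x := f x) hk0 pA); rewrite -fM.
  by rewrite hop_xx linear0.
by rewrite hop_xy.
Qed.
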